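(* Let $A = \{ 1+3j : j \in \mathbb{Z}_{\ge 0} \}$ and $\bar{A} = \mathbb{Z}_{>0} \setminus A$. Let $\alpha \approx 0.6572981061$ and $\beta, \gamma \approx -0.5786490531 \pm 0.6525757633\, i$ be the three roots of the polynomial $1 - x^2 - 2x^3$. Then for every positive integer $n$, the number $c_{\bar{A}}(n)$ of compositions of $n$ all of whose parts lie in $\bar{A}$ (i.e., no part is congruent to $1$ modulo $3$) satisfies \[ c_{\bar{A}}(n) = \frac{1+\alpha}{2+6\alpha}\left(\frac{1}{\alpha}\right)^n + \frac{1+\beta}{2+6\beta}\left(\frac{1}{\beta}\right)^n + \frac{1+\gamma}{2+6\gamma}\left(\frac{1}{\gamma}\right)^n . \]
   Context: A composition of a positive integer $n$ is a $k$-tuple $(\lambda_1,\dots,\lambda_k)\in\mathbb{Z}_{>0}^k$ (for some $k\ge 1$) with $\lambda_1+\dots+\lambda_k=n$; the $\lambda_i$ are its parts, and order matters. For a set $B\subseteq\mathbb{Z}_{>0}$, $c_B(n)$ denotes the number of compositions of $n$ (of any length) all of whose parts lie in $B$. *)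

(* Defs.v *)
From mathcomp Require Import all_boot all_order all_algebra.
From mathcomp Require Import finmap.
From mathcomp Require Import boolp classical_sets functions cardinality reals.
From mathcomp Require Export complex.

Set Implicit Arguments.
Unset Strict Implicit.
Unset Printing Implicit Defensive.

Import Order.TTheory GRing.Theory Num.Theory.
Local Open Scope classical_set_scope.
Local Open Scope ring_scope.

Definition is_composition (n : nat) (l : seq nat) : Prop :=
  [/\ l != [::], all (fun x => (0 < x)%N) l & sumn l = n].

Definition compositions_in (B : set nat) (n : nat) : set (seq nat) :=
  [set l | is_composition n l /\ forall x, x \in l -> B x].

(* [fset_set] returns the empty set on infinite sets, so [comp_count] relies on
   this lemma. *)
Lemma finite_compositions_in (B : set nat) (n : nat) :
  finite_set (compositions_in B n).
Proof.
have size_le (l : seq nat) :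
    all (fun x => (0 < x)%N) l -> (size l <= sumn l)%N.
  elim: l => //= x l IH /andP[x0 /IH]; rewrite -add1n; exact: leq_add.
have part_le (l : seq nat) (x : nat) : x \in l -> (x <= sumn l)%N.
  elim: l => //= y l IH; rewrite inE => /orP[/eqP->|/IH xl].
    exact: leq_addr.
  exact: leq_trans xl (leq_addl _ _).
pose f (b : n.-bseq 'I_n.+1) : seq nat := map val b.
apply: (@sub_finite_set _ _ (f @` [set: n.-bseq 'I_n.+1])); last first.
  exact/finite_image/finite_finset.
move=> l [[_ lpos ln] _].
have sz : (size (map (@inord n) l) <= n)%N.
  by rewrite size_map -[leqRHS]ln size_le.
exists (Bseq sz) => //; rewrite /f /= -map_comp -[RHS]map_id.
apply/eq_in_map => x xl /=; rewrite inordK// ltnS -ln; exact: part_le.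
Qed.

Definition comp_count (B : set nat) (n : nat) : nat :=
  #|` fset_set (compositions_in B n)|.

Definition partsA : set nat := [set (1 + 3 * j)%N | j in [set: nat]].

Definition partsAbar : set nat := [set m | (0 < m)%N] `\` partsA.

Section Roots.
Variable R : realType.

Definition cubic : {poly R[i]} := 1 - 'X^2 - 2%:P * 'X^3.

Definition three_roots (a b c : R[i]) : Prop :=
  uniq [:: a; b; c] /\ forall x : R[i], root cubic x = (x \in [:: a; b; c]).

(* [decimal [:: d1; ...; dk]] is the real number 0.d1...dk. *)
Definition decimal (ds : seq nat) : R := foldr (fun d x => (d%:R + x) / 10) 0 ds.

(* [y] is the value of [x] rounded to ten decimal places. *)
Definition approx10 (x y : R) : Prop := `|x - y| <= 2^-1 / 10 ^+ 10.

Definition root_values (a b c : R[i]) : Prop :=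
  let u := decimal [:: 6; 5; 7; 2; 9; 8; 1; 0; 6; 1]%N in
  let v := decimal [:: 5; 7; 8; 6; 4; 9; 0; 5; 3; 1]%N in
  let w := decimal [:: 6; 5; 2; 5; 7; 5; 7; 6; 3; 3]%N in
  [/\ complex.Im a = 0 /\ approx10 (complex.Re a) u,
      approx10 (complex.Re b) (- v) /\ approx10 (complex.Im b) w
    & approx10 (complex.Re c) (- v) /\ approx10 (complex.Im c) (- w)].

End Roots.

(* Main.v *)
(** In a composition with no part congruent to 1 modulo 3, the first part is 2,
    is 3, or is at least 5 and can be lowered by 3.  Hence c(n) = c(n-2) + 2 c(n-3)
    for n > 3, the recurrence satisfied by 1/x^n for every root x of the cubic.  Since
    1 - x^2 - 2x^3 has roots with a+b+c = -1/2, ab+bc+ca = 0, abc = 1/2, one has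
    x (2 + 6x) = 2 (x-y) (x-z) and 1/x = 2yz, so the initial values n = 1, 2, 3
    are Lagrange interpolation identities.
    The numerical values come from bracketing the real root [a] to 12 digits; the
    other two are then explicit in [a]. *)

Require Import Defs.
From mathcomp Require Import all_boot all_order all_algebra.
From mathcomp Require Import reals.
From mathcomp Require Import finmap boolp classical_sets cardinality.
From mathcomp Require Import ring lra zify.

Set Implicit Arguments.
Unset Strict Implicit.
Unset Printing Implicit Defensive.

Import Order.TTheory GRing.Theory Num.Theory.
Local Open Scope ring_scope.

(** * An explicit list of the compositions with no part congruent to 1 modulo 3 *)

Lemma partsAbarE (m : nat) : partsAbar m <-> (0 < m)%N && (m %% 3 != 1)%N.
Proof.
split=> [[m0 notA]|/andP[m0 m1]].
  rewrite m0 /=; apply/eqP => m1; apply: notA.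
  by exists (m %/ 3)%N => //; lia.
by split=> // -[j _ jm]; move: m1; rewrite -jm; lia.
Qed.

Definition avoiding (l : seq nat) : bool :=
  all (fun m => (0 < m)%N && (m %% 3 != 1)%N) l.

Lemma compositions_in_partsAbarE (n : nat) (l : seq nat) :
  compositions_in partsAbar n l <-> [&& l != [::], avoiding l & sumn l == n].
Proof.
split=> [[[-> _ ->] lB]|/and3P[l0 /allP lA /eqP ln]].
  by rewrite eqxx andbT; apply/allP => m /lB /partsAbarE.
split; last by move=> m /lA /partsAbarE.
by split=> //; apply/allP => m /lA /andP[].
Qed.

(** Adding 3 keeps the residue of the first part modulo 3 and inverts the lowering of a first part
    that is at least 5. The value on [[::]] is a filler, since only nonempty compositions get
    bumped. *)
Definition bump3 (l : seq nat) : seq nat :=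
  if l is m :: l' then (m + 3)%N :: l' else [::].

(* For [n <= 3] what follows the first part may be empty. *)
Fixpoint enum_avoiding (n : nat) : seq (seq nat) :=
  match n with
  | 0 | 1 => [::]
  | 2 => [:: [:: 2%N]]
  | 3 => [:: [:: 3%N]]
  | ((n'.+1 as m).+1).+1 =>
      map (cons 2%N) (enum_avoiding m) ++
      map (cons 3%N) (enum_avoiding n') ++ map bump3 (enum_avoiding n')
  end.

Lemma enum_avoidingSSSS (n : nat) :
  enum_avoiding n.+4 =
    map (cons 2%N) (enum_avoiding n.+2) ++
    map (cons 3%N) (enum_avoiding n.+1) ++ map bump3 (enum_avoiding n.+1).
Proof. by []. Qed.

Lemma avoiding_sumn_le1 (l : seq nat) :
  avoiding l -> (sumn l <= 1)%N -> l = [::].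
Proof. by case: l => //= m l /andP[/andP[m0 m1] _] ml; lia. Qed.

Lemma mem_map_cons (T : eqType) (x y : T) (l : seq T) (s : seq (seq T)) :
  (y :: l \in map (cons x) s) = (y == x) && (l \in s).
Proof.
apply/mapP/andP => [[l' l's [-> ->]]|[/eqP-> ls]]; last by exists l.
by rewrite eqxx.
Qed.

Lemma mem_map_bump3 (m : nat) (l : seq nat) (s : seq (seq nat)) :
  [::] \notin s ->
  (m :: l \in map bump3 s) = (3 <= m)%N && ((m - 3)%N :: l \in s).
Proof.
move=> s0; apply/mapP/andP => [[[|x l'] l's //= [-> ->]]|[m3 ls]].
  by rewrite addnK leq_addl.
by exists ((m - 3)%N :: l); rewrite //= subnK.
Qed.

Lemma mem_enum_avoiding (n : nat) (l : seq nat) :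
  (l \in enum_avoiding n) = [&& l != [::], avoiding l & sumn l == n].
Proof.
elim/ltn_ind: n l => -[|[|[|[|n]]]] IH l; rewrite ?enum_avoidingSSSS.
- case: l => // m l; rewrite in_nil; apply/esym/negbTE/negP => /=.
  by move=> /andP[/andP[/andP[m0 m1] _]]; lia.
- case: l => // m l; rewrite in_nil; apply/esym/negbTE/negP => /=.
  by move=> /andP[/andP[/andP[m0 m1] _]]; lia.
- rewrite inE; apply/eqP/and3P => [->|[]] //.
  case: l => //= m l _ /andP[/andP[m0 m1] lA] /eqP lm.
  have l0 : l = [::] by apply: avoiding_sumn_le1 => //; lia.
  by move: lm; rewrite l0 /= => lm; rewrite (_ : m = 2)//; lia.
- rewrite inE; apply/eqP/and3P => [->|[]] //.
  case: l => //= m l _ /andP[/andP[m0 m1] lA] /eqP lm.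
  have l0 : l = [::] by apply: avoiding_sumn_le1 => //; lia.
  by move: lm; rewrite l0 /= => lm; rewrite (_ : m = 3)//; lia.
have n0 : [::] \notin enum_avoiding n.+1 by rewrite IH //; lia.
case: l => [|m l].
  rewrite !mem_cat; apply/negbTE; rewrite !negb_or.
  by apply/and3P; split; apply/mapP => -[[|? ?]] //; rewrite (negPf n0).
rewrite !mem_cat !mem_map_cons mem_map_bump3 // !IH; try lia.
have [lA|lA] := boolP (avoiding l); last first.
  by rewrite /= -/(avoiding l) (negPf lA) !andbF.
rewrite /= -/(avoiding l) lA /= !andbT.
(* All parts are positive, so emptiness of the tail can be read off its sum; what remains is linear
   arithmetic in [m], [sumn l] and [n]. *)
have -> : (l != [::]) = (0 < sumn l)%N.
  by case: l lA => //= x l /andP[/andP[x0 _] _]; lia.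
lia.
Qed.

(** The three blocks are disjoint because their members have first part 2, first part 3, and first
    part at least 5. *)
Lemma enum_avoiding_uniq (n : nat) : uniq (enum_avoiding n).
Proof.
elim/ltn_ind: n => -[|[|[|[|n]]]] IH //; rewrite enum_avoidingSSSS.
have n0 : [::] \notin enum_avoiding n.+1 by rewrite mem_enum_avoiding.
have consI (m : nat) : injective (cons m) by move=> ? ? [].
rewrite !cat_uniq !(map_inj_uniq (consI _)) !IH ?andTb //; try lia.
apply/and3P; split.
- apply/hasPn => -[|m l]; first by rewrite mem_cat => _; apply/mapP => -[].
  rewrite mem_cat !mem_map_cons mem_map_bump3 //; apply: contraTN.
  by move=> /andP[/eqP-> _].
- apply/hasPn => -[|m l]; first by move=> _; apply/mapP => -[].
  rewrite mem_map_cons mem_map_bump3 // mem_enum_avoiding.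
  by move=> /andP[_ /and3P[_ /andP[/andP[m3 _] _] _]]; lia.
rewrite map_inj_in_uniq; first by apply: IH; lia.
(* [bump3] is injective on nonempty lists, and [n0] excludes the empty one. *)
move=> -[|x l] [|y l'] //; rewrite ?(negPf n0) //.
by move=> _ _ [/addIn-> ->].
Qed.

Lemma comp_count_partsAbar (n : nat) :
  comp_count partsAbar n = size (enum_avoiding n).
Proof.
rewrite /comp_count -(undup_id (enum_avoiding_uniq n)) -card_fseq.
apply/perm_size/uniq_perm; rewrite ?fset_uniq // => l.
rewrite in_fset_set; last exact: finite_compositions_in.
apply/idP/idP; rewrite !inE mem_enum_avoiding.
  by move=> /compositions_in_partsAbarE.
by move=> H; apply/compositions_in_partsAbarE.
Qed.

Lemma size_enum_avoidingSSSS (n : nat) :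
  size (enum_avoiding n.+4) =
    (size (enum_avoiding n.+2) + 2 * size (enum_avoiding n.+1))%N.
Proof. by rewrite enum_avoidingSSSS !size_cat !size_map mul2n addnn. Qed.

(** * Relations between the roots, and the closed form *)

Lemma vieta_cubic (F : numFieldType) (a b c : F) : uniq [:: a; b; c] ->
  {in [:: a; b; c], forall x, 1 - x ^+ 2 - 2 * x ^+ 3 = 0} ->
  [/\ 2 * (a + b + c) = - 1, a * b + b * c + c * a = 0 & 2 * (a * b * c) = 1].
Proof.
rewrite /= !inE negb_or andbT => /andP[/andP[ab ac] bc] H.
have ra := H a (mem_head _ _).
have rb : 1 - b ^+ 2 - 2 * b ^+ 3 = 0 by apply: H; rewrite !inE eqxx orbT.
have rc : 1 - c ^+ 2 - 2 * c ^+ 3 = 0 by apply: H; rewrite !inE eqxx !orbT.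
(* Divided differences: subtracting the equations of two distinct roots and cancelling [x - y] gives
   a quadratic relation. Doing the same to two such relations that share [a] gives the sum of the
   roots. *)
have quad (x y : F) : x != y -> 1 - x ^+ 2 - 2 * x ^+ 3 = 0 ->
    1 - y ^+ 2 - 2 * y ^+ 3 = 0 -> x + y + 2 * (x ^+ 2 + x * y + y ^+ 2) = 0.
  rewrite -subr_eq0 => xy rx ry; apply: (mulfI xy); rewrite mulr0.
  by rewrite -[RHS](subrr 0) -{1}ry -rx; ring.
have qab := quad _ _ ab ra rb; have qac := quad _ _ ac ra rc.
have e1 : 2 * (a + b + c) = - 1.
  rewrite -subr_eq0 in bc; apply: (mulfI bc); apply/eqP; rewrite -subr_eq0.
  by rewrite -[X in _ == X](subrr 0) -{1}qab -qac; apply/eqP; ring.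
have nz2 : (2 : F) != 0 by rewrite pnatr_eq0.
have e2 : a * b + b * c + c * a = 0.
  apply: (mulfI nz2); rewrite mulr0.
  have -> : 2 * (a * b + b * c + c * a) =
    (a + b) * (2 * (a + b + c) + 1) - (a + b + 2 * (a ^+ 2 + a * b + b ^+ 2)) by ring.
  by rewrite e1 qab; ring.
split=> //.
have -> : 2 * (a * b * c) =
    2 * a * (a * b + b * c + c * a) - a ^+ 2 * (2 * (a + b + c) + 1)
    + 1 - (1 - a ^+ 2 - 2 * a ^+ 3) by ring.
by rewrite ra e1 e2; ring.
Qed.

Lemma factor_cubic (F : numFieldType) (a b c x : F) :
  2 * (a + b + c) = - 1 -> a * b + b * c + c * a = 0 -> 2 * (a * b * c) = 1 ->
  1 - x ^+ 2 - 2 * x ^+ 3 = - 2 * ((x - a) * (x - b) * (x - c)).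
Proof.
move=> e1 e2 e3.
have -> : - 2 * ((x - a) * (x - b) * (x - c)) =
  2 * (a * b * c) - 2 * (a * b + b * c + c * a) * x
  + 2 * (a + b + c) * x ^+ 2 - 2 * x ^+ 3 by ring.
by rewrite e1 e2 e3; ring.
Qed.

Definition binet_term (F : numFieldType) (x : F) (n : nat) : F :=
  (1 + x) / (2 + 6 * x) * (1 / x) ^+ n.

Lemma binet_termSSSS (F : numFieldType) (x : F) (n : nat) :
  1 - x ^+ 2 - 2 * x ^+ 3 = 0 ->
  binet_term x n.+4 = binet_term x n.+2 + 2 * binet_term x n.+1.
Proof.
move=> rx.
have x0 : x != 0.
  by apply/eqP => x0; have /eqP := rx; rewrite x0 !expr0n !(mulr0, subr0) oner_eq0.
rewrite /binet_term.
suff -> : (1 / x) ^+ n.+4 = (1 / x) ^+ n.+2 + 2 * (1 / x) ^+ n.+1.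
  by ring.
(* The cubic divided by [x ^+ 3]. *)
suff : (1 / x) ^+ 3 = 1 / x + 2.
  by rewrite -[n.+4]addn3 exprD => ->; rewrite mulrDr -exprSr [_ * 2]mulrC.
apply/eqP; rewrite -subr_eq0.
have -> : (1 / x) ^+ 3 - (1 / x + 2) = (1 - x ^+ 2 - 2 * x ^+ 3) / x ^+ 3.
  by field.
by rewrite rx mul0r.
Qed.

(** One factor [1 / x] turns the denominator into [x * (2 + 6 * x)], which is minus the derivative
    of the cubic at [x], hence [2 * (x - y) * (x - z)]. Only differences of roots are left as
    denominators. *)
Lemma binet_termE (F : numFieldType) (x y z : F) (n : nat) :
  x != y -> x != z ->
  2 * (x + y + z) = - 1 -> x * y + y * z + z * x = 0 -> 2 * (x * y * z) = 1 ->
  binet_term x n.+1 = (1 + x) / (2 * (x - y) * (x - z)) * (2 * y * z) ^+ n.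
Proof.
move=> xy xz e1 e2 e3; rewrite /binet_term exprS mulrA.
have x0 : x != 0.
  by apply: contra_eqN e3 => /eqP->; rewrite !(mul0r, mulr0) eq_sym oner_eq0.
have -> : 1 / x = 2 * y * z.
  by apply: (mulIf x0); rewrite mulfVK // -[LHS]e3; ring.
congr (_ * _).
have dE : x * (2 + 6 * x) = 2 * (x - y) * (x - z).
  have -> : x * (2 + 6 * x) = 2 * (x - y) * (x - z)
     + 2 * x * (2 * (x + y + z) + 1) - 2 * (x * y + y * z + z * x) by ring.
  by rewrite e1 e2; ring.
have : x * (2 + 6 * x) != 0.
  by rewrite dE !mulf_neq0 ?subr_eq0 // pnatr_eq0.
rewrite -dE mulf_eq0 negb_or => /andP[_ d0].
have -> : 2 * y * z = (2 * (x * y * z)) / x by field.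
by rewrite e3; field; rewrite d0 x0.
Qed.

Lemma binet_sum (F : numFieldType) (a b c : F) (n : nat) : uniq [:: a; b; c] ->
  {in [:: a; b; c], forall x, 1 - x ^+ 2 - 2 * x ^+ 3 = 0} ->
  (size (enum_avoiding n.+1))%:R =
    binet_term a n.+1 + binet_term b n.+1 + binet_term c n.+1.
Proof.
move=> abc_uniq abc_root; elim/ltn_ind: n => n IH.
have [n3|] := ltnP n 3; last first.
  case: n IH => [|[|[|n]]] // IH _.
  rewrite size_enum_avoidingSSSS natrD natrM !IH; try lia.
  rewrite !binet_termSSSS; try by apply: abc_root; rewrite !inE eqxx ?orbT.
  by ring.
have [e1 e2 e3] := vieta_cubic abc_uniq abc_root.
move: abc_uniq; rewrite /= !inE negb_or andbT => /andP[/andP[ab ac] bc].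
have ba : b != a by rewrite eq_sym.
have ca : c != a by rewrite eq_sym.
have cb : c != b by rewrite eq_sym.
have termA := binet_termE n ab ac e1 e2 e3.
have termB : binet_term b n.+1 =
    (1 + b) / (2 * (b - c) * (b - a)) * (2 * c * a) ^+ n.
  by apply: binet_termE => //; rewrite -?e1 -?[RHS]e2 -?[RHS]e3; ring.
have termC : binet_term c n.+1 =
    (1 + c) / (2 * (c - a) * (c - b)) * (2 * a * b) ^+ n.
  by apply: binet_termE => //; rewrite -?e1 -?[RHS]e2 -?[RHS]e3; ring.
rewrite termA termB termC => {termA termB termC}.
have sub_neq0 (x y : F) : x != y -> x - y != 0 by rewrite subr_eq0.
(* Summing a polynomial of degree at most 1 against [1 / ((x - y) * (x - z))] gives 0, and the
   quotients [y * z / ((x - y) * (x - z))] are the Lagrange basis polynomials at 0, with sum 1. In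
   the third case the sum is a symmetric function whose value comes from [e2] and [e3]. *)
case: n n3 {IH} => [|[|[|//]]] _.
- transitivity (0 : F) => //.
  by field; rewrite !sub_neq0.
- transitivity (1 : F) => //.
  by field; rewrite !sub_neq0.
- transitivity (2 * (a * b + b * c + c * a) + 2 * (a * b * c)).
    by rewrite e2 e3 mulr0 add0r.
  by field; rewrite !sub_neq0.
Qed.

(** * Existence and numerical values of the roots *)

Lemma root_cubicE (R : realType) (x : R[i]) :
  root (cubic R) x = (1 - x ^+ 2 - 2 * x ^+ 3 == 0).
Proof. by rewrite rootE /cubic !hornerE. Qed.

Lemma real_root_cubic (R : realType) : exists a : R,
  [/\ 1 - a ^+ 2 - 2 * a ^+ 3 = 0,
      decimal R [:: 6; 5; 7; 2; 9; 8; 1; 0; 6; 1; 3; 8]%N <= a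
    & a <= decimal R [:: 6; 5; 7; 2; 9; 8; 1; 0; 6; 1; 3; 9]%N].
Proof.
(* The cubic is negated so that it goes from negative to positive across the bracket, as [poly_ivt]
   expects. *)
pose p : {poly R} := 2%:P * 'X^3 + 'X^2 - 1.
have pE (x : R) : p.[x] = 2 * x ^+ 3 + x ^+ 2 - 1 by rewrite /p !hornerE.
pose lo := decimal R [:: 6; 5; 7; 2; 9; 8; 1; 0; 6; 1; 3; 8]%N.
pose hi := decimal R [:: 6; 5; 7; 2; 9; 8; 1; 0; 6; 1; 3; 9]%N.
have lohi : lo <= hi by rewrite /lo /hi /decimal /=; lra.
have p_lohi : p.[lo] <= 0 <= p.[hi].
  by rewrite !pE /lo /hi /decimal /=; apply/andP; split; lra.
have [x /andP[lox xhi] /rootP] := poly_ivt lohi p_lohi.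
by rewrite pE => px; exists x; split=> //; lra.
Qed.

Lemma exists_cubic_roots (R : realType) :
  exists a b c : R[i], three_roots a b c /\ root_values a b c.
Proof.
have [a [ra loa ahi]] := real_root_cubic R.
(* The other two roots have sum [- (1 + 2 * a) / 2] and product [a * (1 + 2 * a) / 2]. So [p] is
   half the sum, and [D] is the product minus [p ^+ 2], the square of the imaginary part. *)
pose D := (1 + 2 * a) * (6 * a - 1) / 16; pose q := Num.sqrt D.
pose p := - (1 + 2 * a) / 4.
set lo := decimal R _ in loa; set hi := decimal R _ in ahi.
(* Both factors of [D] are positive and increasing in [a] on the bracket, so the bounds on [a] carry
   over to [D]. *)
have Dlo : (1 + 2 * lo) * (6 * lo - 1) / 16 <= D.
  rewrite /D ler_wpM2r ?ler_pM //; try lra.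
  - by rewrite /lo /decimal /=; lra.
  - by rewrite /lo /decimal /=; lra.
have Dhi : D <= (1 + 2 * hi) * (6 * hi - 1) / 16.
  rewrite /D ler_wpM2r ?ler_pM //; try lra.
  - by move: loa; rewrite /lo /decimal /=; lra.
  - by move: loa; rewrite /lo /decimal /=; lra.
have D0 : 0 <= D.
  by apply: le_trans Dlo; rewrite /lo /decimal /=; lra.
have q0 : 0 <= q by exact: sqrtr_ge0.
have q2 : q ^+ 2 = D by rewrite sqr_sqrtr.
pose A : R[i] := (a +i* 0)%C; pose B := (p +i* q)%C; pose C := (p +i* (- q))%C.
have complexE (x y : R[i]) : complex.Re x = complex.Re y ->
  complex.Im x = complex.Im y -> x = y by case: x y => [? ?] [? ?] /= -> ->.
have qgt0 : 0 < q.
  rewrite lt_def q0 andbT -sqrf_eq0 q2 gt_eqF // (lt_le_trans _ Dlo) //.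
  by rewrite /lo /decimal /=; lra.
have e1 : 2 * (A + B + C) = - 1.
  by apply: complexE; rewrite /= /p; simpc; field.
have pq : p ^+ 2 + q ^+ 2 = a * (1 + 2 * a) / 2 by rewrite q2 /p /D; field.
have e2 : A * B + B * C + C * A = 0.
  apply: complexE; rewrite /=; simpc; last by rewrite /p; field.
  transitivity (2 * a * p + (p ^+ 2 + q ^+ 2)); first by ring.
  by rewrite pq /p; field.
(* The choice of [p] and [q] gives [e1] and [e2]; this relation is where the equation satisfied by
   [a] enters. *)
have e3 : 2 * (A * B * C) = 1.
  apply: complexE; rewrite /=; simpc; last by ring.
  transitivity (2 * a * (p ^+ 2 + q ^+ 2)); first by ring.
  rewrite pq; transitivity (1 - (1 - a ^+ 2 - 2 * a ^+ 3)); first by field.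
  by rewrite ra subr0.
have p_approx : approx10 p (- decimal R [:: 5; 7; 8; 6; 4; 9; 0; 5; 3; 1]%N).
  rewrite /approx10 ler_distl /p.
  by move: loa ahi; rewrite /lo /hi /decimal /=; lra.
(* Both bounds are compared after squaring, which replaces the square root by [D] and leaves
   rational arithmetic. *)
have q_approx : approx10 q (decimal R [:: 6; 5; 2; 5; 7; 5; 7; 6; 3; 3]%N).
  rewrite /approx10 ler_distl; apply/andP; split.
    rewrite -(ler_pXn2r (ltn0Sn 1)) ?nnegrE ?q2 //; last first.
      by rewrite /decimal /=; lra.
    by apply: le_trans Dlo; rewrite /lo /decimal /=; lra.
  rewrite -(ler_pXn2r (ltn0Sn 1)) ?nnegrE ?q2 //; last first.
    by rewrite /decimal /=; lra.
  by apply: le_trans Dhi _; rewrite /hi /decimal /=; lra.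
exists A, B, C; split; [split|split].
- rewrite /= !inE negb_or andbT !eq_complex /=.
  have [-> -> ->] : [/\ (0 == q) = false, (0 == - q) = false & (q == - q) = false].
    by split; apply/eqP; lra.
  by rewrite !andbF.
- move=> x; rewrite root_cubicE (factor_cubic x e1 e2 e3) !inE.
  by rewrite !mulf_eq0 !subr_eq0 oppr_eq0 pnatr_eq0 /= orbA.
- split=> //; rewrite /approx10 ler_distl.
  by move: loa ahi; rewrite /lo /hi /decimal /=; lra.
- by split.
- by split=> //; rewrite /approx10 /= opprK addrC distrC.
Qed.

Unset Implicit Arguments.

Theorem theorem5 (R : realType) :
  (exists a b c : R[i], three_roots a b c /\ root_values a b c) /\
  (forall a b c : R[i], three_roots a b c ->
   forall n : nat, (0 < n)%N ->
     (comp_count partsAbar n)%:R =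
       (1 + a) / (2 + 6 * a) * (1 / a) ^+ n +
       (1 + b) / (2 + 6 * b) * (1 / b) ^+ n +
       (1 + c) / (2 + 6 * c) * (1 / c) ^+ n).
Proof.
split; first exact: exists_cubic_roots.
move=> a b c [abc_uniq abc_root] [//|n] _.
rewrite comp_count_partsAbar; apply: binet_sum => // x.
by rewrite -abc_root root_cubicE => /eqP.
Qed.
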